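(* Let $k\ge2$, let $v\in S_k$ be fixed, let $0<\theta<1$ and $0<\kappa<1$ be such that $T_{v,1}$ is bounded on $\mathcal{B}_{\theta,\kappa}$, and let $x_\varnothing\in\mathsf{X}_v$ be the state corresponding to the empty permutation with its (trivial) frontier. Then, for every $n\ge0$, $$(T_{v,1}^\ast)^n\delta_{x_\varnothing}(\mathbf{1})=|\mathrm{Av}_n(v)|,$$ where $\mathbf{1}$ denotes the everywhere-$1$ function on $\mathsf{X}_v$ and $$(T_{v,1}^\ast)^n\delta_{x_\varnothing}(\mathbf{1}):=\sum_{y\in\mathsf{X}_v}(T_{v,1}^\ast)^n\delta_{x_\varnothing}(y).$$
   Context: Permutations are written in one-line notation; $S_n$ is the set of permutations of $\{1,\dots,n\}$ ($S_0$ contains only the empty permutation $\varnothing$); $\sim$ denotes order-isomorphism of sequences. A permutation avoids $v\in S_k$ if no length-$k$ subsequence of it is order-isomorphic to $v$; $\mathrm{Av}_n(v)$ is the set of $\pi\in S_n$ avoiding $v$ and $\mathrm{Av}(v)=\bigcup_n\mathrm{Av}_n(v)$. Right insertion: for $\pi\in S_n$, $r\in\{1,\dots,n+1\}$, $\mathrm{ins}(\pi,r)\in S_{n+1}$ is obtained by increasing by $1$ every value of $\pi$ that is $\ge r$ and appending the value $r$ at position $n+1$. Frontier: for $\pi\in S_n$ avoiding $v$, a $(k-1)$-partial occurrence of $v$ in $\pi$ is a tuple $i_1<\dots<i_{k-1}$ of positions with $(\pi_{i_1},\dots,\pi_{i_{k-1}})\sim(v_1,\dots,v_{k-1})$. Its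 forbidden rank set $J_\pi(i_1,\dots,i_{k-1})$ is the set of $r\in\{1,\dots,n+1\}$ such that $\pi'=\mathrm{ins}(\pi,r)$ satisfies $(\pi'_{i_1},\dots,\pi'_{i_{k-1}},\pi'_{n+1})\sim(v_1,\dots,v_k)$. The frontier $\mathcal{F}_v(\pi)$ is the set of all $(k-1)$-partial occurrences with nonempty forbidden rank set, and $\mathrm{Forb}_v(\pi)=\bigcup_{p\in\mathcal{F}_v(\pi)}J_\pi(p)$. State space: $\mathsf{X}_v$ is the set of pairs $x=(\pi,\mathcal{F}_v(\pi))$ with $\pi\in\mathrm{Av}(v)$; $m(x)=|\mathcal{F}_v(\pi)|$, $s(x)=|\pi|$ (length), $A_v(x)=\{1,\dots,s(x)+1\}\setminus\mathrm{Forb}_v(\pi)$, and for $r\in A_v(x)$, $\Phi_v(x,r)=(\pi',\mathcal{F}_v(\pi'))\in\mathsf{X}_v$ with $\pi'=\mathrm{ins}(\pi,r)$. $\mathcal{B}_{\theta,\kappa}$ is the Banach space of $f:\mathsf{X}_v\to\mathbb{C}$ with $\|f\|_{\theta,\kappa}:=\sup_{x}\theta^{-m(x)}\kappa^{-s(x)^2}|f(x)|<\infty$, and $(T_{v,1}f)(x):=\sum_{r\in A_v(x)}f(\Phi_v(x,r))$. $\mathcal{B}^0_{\theta,\kappa}$ is the closed, $T_{v,1}$-invariant subspace of $f\in\mathcal{B}_{\theta,\kappa}$ with $\theta^{-m(x)}\kappa^{-s(x)^2}|f(x)|\to0$ as $s(x)\to\infty$. With $w(x)=\theta^{m(x)}\kappa^{s(x)^2}$,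 its dual is identified with $\ell^1(\mathsf{X}_v,w)=\{\mu:\mathsf{X}_v\to\mathbb{C}:\sum_x|\mu(x)|w(x)<\infty\}$ via $\langle\mu,f\rangle=\sum_x\mu(x)f(x)$. The adjoint $T_{v,1}^\ast$ on $\ell^1(\mathsf{X}_v,w)$ is defined by $\langle T_{v,1}^\ast\mu,f\rangle=\langle\mu,T_{v,1}f\rangle$ for all $f\in\mathcal{B}^0_{\theta,\kappa}$; explicitly, $$(T_{v,1}^\ast\mu)(y)=\sum_{x\in\mathsf{X}_v,\ r\in A_v(x),\ \Phi_v(x,r)=y}\mu(x).$$ $\delta_{x_\varnothing}$ is the function equal to $1$ at $x_\varnothing$ and $0$ elsewhere. *)

(* Defs.v *)
From HB Require Import structures.
From mathcomp Require Import all_boot all_order all_algebra all_fingroup.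
From mathcomp Require Import complex.
From mathcomp Require Import all_classical all_reals all_analysis.
From mathcomp Require Import showcase.summability.

Set Implicit Arguments.
Unset Strict Implicit.
Unset Printing Implicit Defensive.

Import Order.TTheory GRing.Theory Num.Theory.
Import numFieldNormedType.Exports.

Local Open Scope ring_scope.

(* Permutations of {1, ..., n} are encoded as permutations 'S_n of
   'I_n = {0, ..., n-1}: positions, values and ranks are all shifted by one. *)

Definition oneline n (s : 'S_n) : seq nat := [seq val (s i) | i <- enum 'I_n].

Definition order_iso (s t : seq nat) : bool :=
  (size s == size t) &&
  [forall i : 'I_(size s), forall j : 'I_(size s),
     (nth 0 s i < nth 0 s j)%N == (nth 0 t i < nth 0 t j)%N].

Definition subword n (s : 'S_n) (p : seq 'I_n) : seq nat :=
  [seq val (s i) | i <- p].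

Definition increasing n (p : seq 'I_n) : bool :=
  sorted ltn [seq val i | i <- p].

Definition avoids k (v : 'S_k) n (s : 'S_n) : bool :=
  [forall p : k.-tuple 'I_n,
     increasing p ==> ~~ order_iso (subword s p) (oneline v)].

Definition Av k (v : 'S_k) (n : nat) : {set 'S_n} := [set s | avoids v s].

(* [lift_perm ord_max r s] sends the last position to r and increases by one
   the values of s that are at least r. *)
Definition ins n (s : 'S_n) (r : 'I_n.+1) : 'S_n.+1 := lift_perm ord_max r s.

Definition widen_last n (i : 'I_n) : 'I_n.+1 := widen_ord (leqnSn n) i.

Definition partial_occ k (v : 'S_k) n (s : 'S_n) (p : k.-1.-tuple 'I_n) : bool :=
  increasing p && order_iso (subword s p) (take k.-1 (oneline v)).

Definition forbidden_ranks k (v : 'S_k) n (s : 'S_n) (p : k.-1.-tuple 'I_n) :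
    {set 'I_n.+1} :=
  [set r | order_iso
     (subword (ins s r) (rcons [seq widen_last i | i <- p] ord_max))
     (oneline v)].

Definition frontier k (v : 'S_k) n (s : 'S_n) : {set k.-1.-tuple 'I_n} :=
  [set p | partial_occ v s p & forbidden_ranks v s p != finset.set0].

Definition Forb k (v : 'S_k) n (s : 'S_n) : {set 'I_n.+1} :=
  (\bigcup_(p in frontier v s) forbidden_ranks v s p)%SET.

Definition pre_state (k : nat) : Type :=
  {n : nat & ('S_n * {set k.-1.-tuple 'I_n})%type}.

Definition is_state k (v : 'S_k) (x : pre_state k) : bool :=
  avoids v (tagged x).1 && ((tagged x).2 == frontier v (tagged x).1).

Definition state k (v : 'S_k) : Type := {x : pre_state k | is_state v x}.

Lemma mk_state_proof k (v : 'S_k) n (s : 'S_n) :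
  avoids v s -> is_state v (Tagged _ (s, frontier v s)).
Proof. by move=> vs; rewrite /is_state /= vs eqxx. Qed.

Definition mk_state k (v : 'S_k) n (s : 'S_n) (vs : avoids v s) : state v :=
  exist _ (Tagged _ (s, frontier v s)) (mk_state_proof vs).

Section States.
Variables (k : nat) (v : 'S_k).
Implicit Types x : state v.

Definition st_size x : nat := tag (val x).
Definition st_perm x : 'S_(st_size x) := (tagged (val x)).1.
Definition st_frontier x : {set k.-1.-tuple 'I_(st_size x)} :=
  (tagged (val x)).2.
Definition st_m x : nat := #|st_frontier x|.

Definition admissible x : {set 'I_(st_size x).+1} := ~: Forb v (st_perm x).

End States.

Lemma order_iso_map_bump r s t : order_iso (map (bump r) s) t = order_iso s t.
Proof.
rewrite /order_iso size_map; case: eqP => //= e.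
apply: eq_forallb => i; apply: eq_forallb => j.
by rewrite !(nth_map 0%N) // !ltnNge leq_bump2.
Qed.

Lemma order_iso_take m s t :
  order_iso s t -> order_iso (take m s) (take m t).
Proof.
move=> /andP[/eqP e /forallP h]; apply/andP; split.
  by rewrite !size_take e.
have lt (i : nat) : (i < size (take m s))%N -> (i < size s)%N && (i < m)%N.
  by rewrite size_take_min leq_min andbC.
apply/forallP => i; apply/forallP => j.
have /andP[i1 i2] := lt i (ltn_ord i); have /andP[j1 j2] := lt j (ltn_ord j).
by rewrite !nth_take //; have /forallP/(_ (Ordinal j1)) := h (Ordinal i1).
Qed.

Lemma subword_ins n (s : 'S_n) (r : 'I_n.+1) (p : seq 'I_n) :
  subword (ins s r) [seq widen_last i | i <- p] = map (bump r) (subword s p).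
Proof.
rewrite /subword -!map_comp; apply: eq_map => i /=.
have -> : widen_last i = lift ord_max i.
  by apply: val_inj; rewrite /= /bump leqNgt ltn_ord.
by rewrite lift_perm_lift.
Qed.

Lemma widen_last_preim n (p : seq 'I_n.+1) :
  all (fun i : 'I_n.+1 => i < n)%N p ->
  exists q : seq 'I_n, p = [seq widen_last i | i <- q].
Proof.
elim: p => [|i p IH] /=; first by exists [::].
move=> /andP[ltin /IH[q ->]]; exists (Ordinal ltin :: q) => /=.
by congr (_ :: _); apply: val_inj.
Qed.

Lemma increasing_widen n (q : seq 'I_n) :
  increasing [seq widen_last i | i <- q] = increasing q.
Proof. by rewrite /increasing -map_comp. Qed.

Lemma increasing_rcons n (p : seq 'I_n.+1) (a : 'I_n.+1) :
  increasing (rcons p a) ->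
  increasing p /\ all (fun i : 'I_n.+1 => i < a)%N p.
Proof.
rewrite /increasing !(sorted_pairwise ltn_trans) map_rcons pairwise_rcons.
by rewrite all_map => /andP[].
Qed.

Lemma avoids_ins k (v : 'S_k) n (s : 'S_n) (r : 'I_n.+1) :
  avoids v s -> r \in ~: Forb v s -> avoids v (ins s r).
Proof.
move=> /forallP vs; rewrite finset.in_setC => rF.
have old (q : seq 'I_n) : size q = k -> increasing q ->
    ~~ order_iso (subword s q) (oneline v).
  by move=> /eqP sq iq; have /implyP := vs (Tuple sq); apply.
apply/forallP => p; apply/implyP => ip; apply/negP => op.
have sp : size p = k by rewrite size_tuple.
move: (tval p) sp ip op => {}p; case/lastP: p => [|p a] sp ip op.
  by have := old [::] sp isT; rewrite op.
have [ip' pa] := increasing_rcons ip.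
have pn : all (fun i : 'I_n.+1 => i < n)%N p.
  by apply: sub_all pa => i /leq_trans; apply; rewrite -ltnS.
have [q pE] := widen_last_preim pn.
have [an|na] := ltnP a n.
  have [|q' qE] := @widen_last_preim n (rcons p a); first by rewrite all_rcons an.
  move: sp ip op; rewrite qE size_map increasing_widen => sq iq.
  by rewrite subword_ins order_iso_map_bump; apply/negP; exact: old.
have aE : a = ord_max.
  by apply/val_inj/eqP; rewrite /= eqn_leq na -ltnS ltn_ord.
move: sp ip' op; rewrite aE pE size_rcons size_map increasing_widen => sq iq op.
have sq' : size q == k.-1 by rewrite -sq.
move/negP: rF; apply; apply/finset.bigcupP.
have rJ : r \in forbidden_ranks v s (Tuple sq') by rewrite inE.
exists (Tuple sq') => //; rewrite inE /partial_occ /= iq /=.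
apply/andP; split; last by apply/finset.set0Pn; exists r.
have := order_iso_take k.-1 op.
rewrite {1}/subword map_rcons -/(subword _ _) -cats1 take_size_cat.
  by rewrite subword_ins order_iso_map_bump.
by rewrite !size_map (eqP sq').
Qed.

Section Dynamics.
Variables (k : nat) (v : 'S_k).

Lemma st_avoids (x : state v) : avoids v (st_perm x).
Proof. by case/andP: (valP x). Qed.

Definition Phi (x : state v) (r : {r | r \in admissible x}) : state v :=
  mk_state (avoids_ins (st_avoids x) (valP r)).

Lemma avoids_empty (hk : (2 <= k)%N) : avoids v (1%g : 'S_0).
Proof.
apply/forallP => p; case: (thead (tcast (esym (prednK (ltnW hk))) p)).
by [].
Qed.

Definition x_empty (hk : (2 <= k)%N) : state v := mk_state (avoids_empty hk).

Variable R : realType.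

(* R[i]^o is the field R[i] of complex numbers, with the topology given by the
   modulus; [Normc.normc] is the R-valued modulus. *)
Implicit Types f mu nu : state v -> R[i]^o.

Definition T_op f : state v -> R[i]^o :=
  fun x => \sum_(r : {r | r \in admissible x}) f (Phi r).

Definition delta (x0 : state v) : state v -> R[i]^o := fun x => (x == x0)%:R.

(* Unordered (net) sum over the state space; over the complex numbers the net
   converges exactly when the family is absolutely summable. *)
Definition summable_family mu : Prop := cvg (partial_sum mu @ totally)%classic.

Definition family_sum mu : R[i]^o := summability.sum mu.

Definition pairing mu f : R[i]^o := family_sum (fun x => mu x * f x).

Variables theta kappa : R.

Definition weight (x : state v) : R :=
  theta ^+ st_m x * kappa ^+ (st_size x ^ 2).

Definition B_ratio f (x : state v) : R :=
  theta ^- st_m x * kappa ^- (st_size x ^ 2) * Normc.normc (f x).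

Definition B_norm f : \bar R :=
  ereal_sup (range (fun x => (B_ratio f x)%:E)).

Definition in_B f : Prop := (B_norm f < +oo)%E.

Definition in_B0 f : Prop :=
  in_B f /\
  forall e : R, 0 < e ->
    exists N : nat, forall x, (N <= st_size x)%N -> B_ratio f x < e.

Definition bounded_on_B (L : (state v -> R[i]^o) -> (state v -> R[i]^o)) : Prop :=
  exists M : R, forall f, in_B f -> (B_norm (L f) <= M%:E * B_norm f)%E.

Definition in_l1w mu : Prop :=
  (\esum_(x in [set: state v]%classic) (Normc.normc (mu x) * weight x)%:E
     < +oo)%E.

Definition is_adjoint_image mu nu : Prop :=
  in_l1w nu /\ forall f, in_B0 f -> pairing nu f = pairing mu (T_op f).

(* For mu in l^1(w) and T_op bounded, [T_adj mu] is the unique nu in l^1(w) such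
   that <nu, f> = <mu, T_op f> on B0; the default value 0 is used only when no
   such nu exists. *)
Definition T_adj mu : state v -> R[i]^o :=
  xget (fun=> 0) [set nu | is_adjoint_image mu nu]%classic.

End Dynamics.

Arguments T_adj {k v R} theta kappa mu _.
Arguments T_op {k v R} f _.
Arguments bounded_on_B {k v R} theta kappa L.
Arguments delta {k v R} x0 _.

(* Main.v *)
(* Every permutation of size n+1 is ins(s, r) for exactly one pair (s, r), and it
   avoids v iff s avoids v and r is not forbidden; hence the transitions Phi
   from size n to size n+1 form a bijection onto the states of size n+1.  So
   T_adj maps the indicator of the states of size n to that of size n+1, and
   (T_adj)^n delta is the indicator of a finite set with #|Av v n| elements.
   The image under T_adj is pinned down by testing against the functions
   delta y, which lie in B0. *)
Require Import Defs.
From mathcomp Require Import all_boot all_order all_algebra all_fingroup.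
From mathcomp Require Import complex finmap.
From mathcomp Require Import all_classical all_reals all_analysis.
From mathcomp Require Import showcase.summability.

Set Implicit Arguments.
Unset Strict Implicit.
Unset Printing Implicit Defensive.

Import Order.TTheory GRing.Theory Num.Theory.
Import numFieldNormedType.Exports.
Local Open Scope ring_scope.

(** * Unordered sums of finitely supported families *)

(** Once a finite set contains [s], its partial sum no longer changes, so the net is eventually
    constant. *)
Lemma cvg_partial_sum_finite_support (I : choiceType) (K : numFieldType)
    (V : normedModType K) (mu : I -> V) (s : seq I) :
  uniq s -> (forall x, x \notin s -> mu x = 0) ->
  (partial_sum mu @ totally --> \sum_(x <- s) mu x)%classic.
Proof.
move=> us mu0; have tF := @totally_filter I.
refine (cvg_near_cst _ _).
exists [fset x in s]%fset => //= A /fsubsetP sA.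
rewrite /partial_sum -(big_seq_fsetE _ A xpredT mu) /=.
rewrite (bigID (fun x => x \in s)) /= [X in _ + X]big1 ?addr0; last first.
  by move=> x; exact: mu0.
rewrite -big_filter; apply: perm_big; apply: uniq_perm => //.
  exact/filter_uniq/fset_uniq.
move=> x; rewrite mem_filter; case: (boolP (x \in s)) => //= xs.
by apply: sA; rewrite in_fset.
Qed.

Lemma family_sum_finite_support k (v : 'S_k) (R : realType)
    (mu : state v -> R[i]^o) (s : seq (state v)) :
  uniq s -> (forall x, x \notin s -> mu x = 0) ->
  family_sum mu = \sum_(x <- s) mu x.
Proof.
move=> us mu0; apply: cvg_lim.
- exact: norm_hausdorff.
- exact: totally_filter.
- exact: cvg_partial_sum_finite_support.
Qed.

(** * Right insertion and avoidance *)

(** The last value gives back [r]; the other values then give back [s], since [lift r] is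
    injective. *)
Lemma insI n : injective (fun p : 'S_n * 'I_n.+1 => ins p.1 p.2).
Proof.
move=> [s r] [s' r'] /= e.
have re : r = r'.
  by have := congr1 (fun t : 'S_n.+1 => t ord_max) e; rewrite !lift_perm_id.
congr (_, _) => //; apply/permP => i; apply: (@lift_inj _ r).
have := congr1 (fun t : 'S_n.+1 => t (lift ord_max i)) e.
by rewrite !lift_perm_lift re.
Qed.

(** By counting: the injection [insI] goes between sets of the same cardinality (n+1)!. *)
Lemma ins_surj n (t : 'S_n.+1) : exists (s : 'S_n) r, t = ins s r.
Proof.
have [||g _ gK] := @inj_card_bij _ _ (fun p : 'S_n * 'I_n.+1 => ins p.1 p.2).
- exact: insI.
- by rewrite card_prod !card_Sn card_ord factS mulnC.
by exists (g t).1, (g t).2; rewrite gK.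
Qed.

Lemma avoids_ins_inv k (v : 'S_k) n (s : 'S_n) (r : 'I_n.+1) :
  avoids v (ins s r) -> avoids v s.
Proof.
move=> /forallP vt; apply/forallP => p; apply/implyP => ip.
have /implyP := vt (map_tuple (@widen_last n) p).
by rewrite increasing_widen subword_ins order_iso_map_bump; apply.
Qed.

(** A forbidden rank completes a partial occurrence, through the new last position, to an occurrence
    of [v]. *)
Lemma avoids_ins_notin_Forb k (v : 'S_k) n (s : 'S_n) (r : 'I_n.+1) :
  (0 < k)%N -> avoids v (ins s r) -> r \in ~: Forb v s.
Proof.
move=> k0 /forallP vt; rewrite finset.in_setC; apply/negP.
move=> /finset.bigcupP[p]; rewrite !inE => /andP[/andP[ip _] _] op.
have sq : size (rcons [seq widen_last i | i <- p] ord_max) == k.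
  by rewrite size_rcons size_map size_tuple prednK.
have /implyP/= := vt (Tuple sq); rewrite op => vp; apply: (negP (vp _)) => //.
rewrite /increasing !(sorted_pairwise ltn_trans) map_rcons pairwise_rcons.
rewrite -(sorted_pairwise ltn_trans).
have := ip; rewrite -increasing_widen /increasing => ->; rewrite andbT.
by apply/allP => _ /mapP[_ /mapP[j _ ->] ->] /=.
Qed.

(** * States of a given size and the transitions between sizes *)

Section Levels.
Variables (k : nat) (v : 'S_k).

Lemma st_mk_state (x : state v) : x = mk_state (st_avoids x).
Proof.
apply/val_inj; case: x => [[n [s F]]] /= xP.
by case/andP: (xP) => _ /eqP/= FE; rewrite /st_perm /= -FE.
Qed.

Lemma mk_state_inj n (s s' : 'S_n) (vs : avoids v s) (vs' : avoids v s') :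
  mk_state vs = mk_state vs' -> s = s'.
Proof. by move=> /(congr1 val) e; case: (eq_from_Tagged e). Qed.

Definition level n : seq (state v) :=
  [seq mk_state (valP s) | s : {s : 'S_n | avoids v s}].

Lemma level_uniq n : uniq (level n).
Proof.
rewrite map_inj_uniq ?enum_uniq // => s s' e.
exact/val_inj/(mk_state_inj e).
Qed.

Lemma mem_level n x : (x \in level n) = (st_size x == n).
Proof.
apply/mapP/eqP => [[s _ ->] //|<-].
exists (Sub (st_perm x) (st_avoids x)); first by rewrite mem_enum.
by rewrite {1}(st_mk_state x); apply/val_inj.
Qed.

Lemma size_level n : size (level n) = #|Av v n|.
Proof.
rewrite size_map -cardE card_sig; apply: eq_card => s.
by rewrite !inE.
Qed.

Lemma PhiI : injective
  (fun u : {x : state v & {r | r \in admissible x}} => Phi (tagged u)).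
Proof.
move=> [x r] [x' r'] /=; move: r r'.
(* In the form [mk_state] both states can be generalized over size and permutation, so the dependent
   types no longer block the identifications below. *)
rewrite (st_mk_state x) (st_mk_state x').
move: (st_perm x) (st_avoids x) (st_perm x') (st_avoids x').
move: (st_size x) (st_size x') => n n' s vs s' vs' r r' e.
have [nn] : n.+1 = n'.+1 := congr1 (@st_size _ v) e.
subst n'.
have [ss rr] := insI (x1 := (_, _)) (x2 := (_, _)) (mk_state_inj e).
rewrite /st_perm /= in ss; subst s'.
rewrite (bool_irrelevance vs' vs) in r' rr e *.
by congr (existT _ _ _); exact: val_inj.
Qed.

Lemma level_succ n : (0 < k)%N ->
  perm_eq (level n.+1)
    [seq Phi r | x <- level n, r <- enum {: {r | r \in admissible x}}].
Proof.
move=> k0; apply: uniq_perm; first exact: level_uniq.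
  apply: allpairs_uniq_dep => [|x _|]; first exact: level_uniq.
    exact: enum_uniq.
  by move=> u w _ _; apply: PhiI.
(* Forward direction: removing the last value of the permutation of [y] yields the source state and
   the rank. *)
move=> y; rewrite mem_level; apply/eqP/allpairsPdep => [yn|].
  rewrite (st_mk_state y).
  move: (st_perm y) (st_avoids y); rewrite yn => t vt.
  have [s [r tE]] := ins_surj t; subst t.
  have vs := avoids_ins_inv vt.
  have rA : r \in admissible (mk_state vs).
    exact: avoids_ins_notin_Forb.
  exists (mk_state vs), (Sub r rA); rewrite mem_level mem_enum; split => //.
  exact: val_inj.
by move=> [x [r]]; rewrite mem_level => -[/eqP<- _ ->].
Qed.

End Levels.

(** * The adjoint on level indicators *)

Section Adjoint.
Variables (k : nat) (v : 'S_k) (R : realType) (theta kappa : R).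
Hypotheses (theta_ge0 : 0 <= theta) (kappa_ge0 : 0 <= kappa).

Definition level_indicator n : state v -> R[i]^o :=
  fun x => (st_size x == n)%:R.

Lemma level_indicator_out n x : x \notin level v n -> level_indicator n x = 0.
Proof. by rewrite mem_level /level_indicator => /negbTE->. Qed.

Lemma pairing_level_indicator n (f : state v -> R[i]^o) :
  pairing (level_indicator n) f = \sum_(x <- level v n) f x.
Proof.
rewrite /pairing (@family_sum_finite_support _ _ _ _ (level v n)).
- apply: eq_big_seq => x; rewrite mem_level /level_indicator => ->.
  by rewrite mul1r.
- exact: level_uniq.
- by move=> x /level_indicator_out ->; rewrite mul0r.
Qed.

Lemma pairing_delta (nu : state v -> R[i]^o) y : pairing nu (delta y) = nu y.
Proof.
rewrite /pairing (@family_sum_finite_support _ _ _ _ [:: y]) //.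
  by rewrite big_seq1 /delta eqxx mulr1.
by move=> x; rewrite inE /delta => /negbTE->; rewrite mulr0.
Qed.

Lemma delta_in_B0 y : in_B0 theta kappa (delta y : state v -> R[i]^o).
Proof.
have ratio_y x : B_ratio theta kappa (delta y : state v -> R[i]^o) x =
    if x == y then B_ratio theta kappa (delta y : state v -> R[i]^o) y else 0.
  rewrite /B_ratio /delta; case: (eqVneq x y) => [->|_]; first by rewrite eqxx.
  by rewrite [Normc.normc _]Normc.normc0 mulr0.
split=> [|e e0].
  apply: (@le_lt_trans _ _
    (B_ratio theta kappa (delta y : state v -> R[i]^o) y)%:E).
    apply: ge_ereal_sup => _ [x _ <-]; rewrite lee_fin ratio_y.
    case: ifP => // _; rewrite /B_ratio /delta eqxx [Normc.normc _]Normc.normc1 mulr1.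
    by rewrite mulr_ge0 // invr_ge0 exprn_ge0.
  exact: ltry.
(* Past the size of [y] the ratio is 0. *)
exists (st_size y).+1 => x xy; rewrite ratio_y.
by case: eqP xy => // ->; rewrite ltnn.
Qed.

Lemma level_indicator_in_l1w n : in_l1w theta kappa (level_indicator n).
Proof.
pose g (x : state v) :=
  (Normc.normc (level_indicator n x) * weight theta kappa x)%:E.
rewrite /in_l1w -/g.
have -> : (\esum_(x in [set: state v]) g x =
    \esum_(x in [set` level v n]) g x)%classic%E.
  rewrite -[in RHS](setTI [set` level v n]%classic) esum_mkcondr.
  apply: eq_esum => x _; case: ifPn => //.
  rewrite notin_setE /= => /negP/level_indicator_out xn.
  by rewrite /g xn [Normc.normc _]Normc.normc0 mul0r.
rewrite esum_fset; first last.
- move=> x _; rewrite lee_fin mulr_ge0 ?mulr_ge0 ?exprn_ge0 //.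
  by rewrite /level_indicator; case: eqP; rewrite (Normc.normc0, Normc.normc1).
- exact: finite_seq.
rewrite fsbig_finite /=; last exact: finite_seq.
by apply: lte_sum_pinfty => x _; exact: ltry.
Qed.

(** The double sum over sources and admissible ranks is reindexed along the bijection of
    [level_succ]. *)
Lemma sum_T_op_level n (f : state v -> R[i]^o) : (0 < k)%N ->
  \sum_(x <- level v n) T_op f x = \sum_(y <- level v n.+1) f y.
Proof.
move=> k0; rewrite (perm_big _ (level_succ _ _ k0)) big_allpairs_dep.
by apply: eq_bigr => x _; rewrite big_enum.
Qed.

Lemma T_adj_level_indicator n : (0 < k)%N ->
  T_adj theta kappa (level_indicator n) = level_indicator n.+1.
Proof.
move=> k0.
have adj f : pairing (level_indicator n.+1) f =
    pairing (level_indicator n) (T_op f).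
  by rewrite !pairing_level_indicator sum_T_op_level.
(* Existence and uniqueness together rule out the default value of [xget]. *)
apply: xget_unique; first by split; [exact: level_indicator_in_l1w|].
move=> nu [_ nuE]; apply/funext => y.
by rewrite -!pairing_delta adj nuE //; exact: delta_in_B0.
Qed.

Lemma delta_x_empty (hk : (2 <= k)%N) :
  delta (x_empty v hk) = level_indicator 0.
Proof.
apply/funext => x; rewrite /delta /level_indicator; congr (_%:R).
congr (nat_of_bool _); apply/eqP/eqP => [-> //|x0].
rewrite (st_mk_state x); move: (st_perm x) (st_avoids x); rewrite x0 => s vs.
(* Two permutations of the empty type ['I_0] agree vacuously. *)
have s1 : s = 1%g by apply/permP => -[].
by subst s; exact: val_inj.
Qed.

End Adjoint.

Theorem lemma4p6 (R : realType) (k : nat) (hk : (2 <= k)%N) (v : 'S_k)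
    (theta kappa : R)
    (htheta : 0 < theta < 1) (hkappa : 0 < kappa < 1)
    (hT : bounded_on_B theta kappa (@T_op k v R))
    (n : nat) :
  let mu := iter n (T_adj theta kappa) (delta (x_empty v hk)) in
  summable_family mu /\ family_sum mu = #|Av v n|%:R.
Proof.
move=> mu.
have [/ltW theta0 _] := andP htheta; have [/ltW kappa0 _] := andP hkappa.
have -> : mu = level_indicator R n.
  rewrite /mu; elim: n {mu} => [|n IH]; first exact: delta_x_empty.
  by rewrite iterS IH T_adj_level_indicator // ltnW.
have out := @level_indicator_out k v R n.
have u := level_uniq v n.
split.
  apply/cvg_ex; exists (\sum_(x <- level v n) level_indicator R n x).
  exact: cvg_partial_sum_finite_support.
(* The cardinal is written as a sum of ones over the level, to be compared term by term with the
   indicator. *)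
rewrite (family_sum_finite_support u out) -size_level -sum1_size natr_sum.
by apply: eq_big_seq => x; rewrite mem_level /level_indicator => ->.
Qed.
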